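(* Let $A$ be a central type. The binary operation $\otimes$ makes $\mathrm{BAut}_1(A)$ (pointed at $A_{|\mathrm{refl}|_0}$) into an abelian H-space.
   Context: We work in homotopy type theory with a univalent universe $\mathcal{U}$. Base points are written $\mathrm{pt}$. For a type $T$ and $t : T$, $T_{(t)} := \sum_{t':T}(|t'|_0 = |t|_0)$. A pointed type $A$ is central if the evaluation map $f \mapsto f(\mathrm{pt}) : (A \to A)_{(\mathrm{id})} \to A$ is an equivalence. A (coherent) H-space structure on a pointed type consists of a binary operation $\mu$, a left unit law $\mu_l : \mu(\mathrm{pt},-) = \mathrm{id}$, a right unit law $\mu_r : \mu(-,\mathrm{pt}) = \mathrm{id}$, and a coherence $\mu_l(\mathrm{pt}) = \mu_r(\mathrm{pt})$. It is abelian if there is a homotopy $\prod_{a,b} \mu(a,b) = \mu(b,a)$. A central type has a unique (coherent) H-space structure, written $a\cdot b$, and each $a \cdot -$ is an equivalence. The inversion map $\mathrm{id}^* : A \to A$ sends $a$ to $a^* := (a \cdot -)^{-1}(\mathrm{pt})$; it is a pointed self-equivalence and an involution. Let $\mathrm{refl}^* : A = A$ be the path associated to $\mathrm{id}^*$ by univalence. $\mathrm{BAut}_1(A) := \sum_{X:\mathcal{U}} \|A = X\|_0$ is the type of types banded by $A$ ($A$-bands), with elements written $X_p$, where $p : \|A = X\|_0$ is the band; it is pointed at $\mathrm{pt} := A_{|\mathrm{refl}|_0}$. The dual of $X_p$ is $X_p^* := X_{p^*}$, where $p^* := |\mathrm{refl}^*|_0 \cdot p$ (path composition in diagrammatic order).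 For $A$-bands $X_p, Y_q$, the (essentially small) identity type $X_p =_{\mathrm{BAut}_1(A)} Y_q$ is itself banded by $A$: since $\|A = (X_p = Y_q)\|_0$ is a set, by induction on $p$ and $q$ it suffices to give a band for $\mathrm{pt} = \mathrm{pt}$, and this is the set truncation of the inverse of $(\mathrm{pt} = \mathrm{pt}) \simeq (A \simeq A)_{(\mathrm{id})} \simeq A$, where the last equivalence is evaluation at $\mathrm{pt}$. The tensor product is $X_p \otimes Y_q := (X_p^* =_{\mathrm{BAut}_1(A)} Y_q)$ with this banding. *)

(* Defs.v *)
(** The statement is one of homotopy type theory, whose identity type must not
    be confused with Rocq's own [eq]: [eq] lives in [Prop] and eliminates into
    every type, which is incompatible with univalence.  We therefore work in
    two-level type theory (Annenkov, Capriotti, Kraus, Sattler).  Rocq is the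
    outer level.  The types of homotopy type theory are the "fibrant" Rocq
    types: they are closed under dependent products and sums, and carry an
    identity type [a == b], distinct from [a = b], whose eliminator J applies
    to fibrant families only. *)

Declare Scope hott_scope.
Delimit Scope hott_scope with hott.
Local Open Scope hott_scope.

Class TypeTheory := {
  fib : Type -> Type;
  fib_forall : forall (A : Type) (B : A -> Type),
    fib A -> (forall a, fib (B a)) -> fib (forall a, B a);
  fib_sig : forall (A : Type) (B : A -> Type),
    fib A -> (forall a, fib (B a)) -> fib {a : A & B a};
  Id : forall (A : Type) (fA : fib A), A -> A -> Type;
  fib_Id : forall (A : Type) (fA : fib A) (a b : A), fib (Id A fA a b);
  idp : forall (A : Type) (fA : fib A) (a : A), Id A fA a a;
  J : forall (A : Type) (fA : fib A) (a : A) (P : forall b, Id A fA a b -> Type),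
    (forall b p, fib (P b p)) ->
    P a (idp A fA a) -> forall b (p : Id A fA a b), P b p;
  J_idp : forall (A : Type) (fA : fib A) (a : A)
    (P : forall b, Id A fA a b -> Type) (fP : forall b p, fib (P b p))
    (d : P a (idp A fA a)), J A fA a P fP d a (idp A fA a) = d
}.

Existing Class fib.
#[global] Existing Instances fib_forall fib_sig fib_Id.

Arguments Id {TypeTheory A fA} a b.
Arguments idp {TypeTheory A fA} {a}.
Arguments J {TypeTheory A fA a} P {fP} d {b} p : rename.
Arguments J_idp {TypeTheory A fA a} P {fP} d : rename.

Notation "a == b" := (Id a b) (at level 70, no associativity) : hott_scope.
Notation "a == b :> T" := (@Id _ T _ a b)
  (at level 70, b at next level, no associativity) : hott_scope.
Notation "u .1" := (projT1 u) (at level 1, left associativity, format "u .1")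
  : hott_scope.
Notation "u .2" := (projT2 u) (at level 1, left associativity, format "u .2")
  : hott_scope.
Notation "( a ; b )" := (existT _ a b) : hott_scope.

Section Paths.
Context {TT : TypeTheory}.

Definition transport {A : Type} {fA : fib A} (B : A -> Type)
    {fB : forall a, fib (B a)} {a b : A} (p : a == b) : B a -> B b :=
  J (fun b _ => B a -> B b) (fun x => x) p.

Definition ap {A B : Type} {fA : fib A} {fB : fib B} (f : A -> B) {a b : A}
    (p : a == b) : f a == f b :=
  J (fun b _ => f a == f b) idp p.

Definition inverse {A : Type} {fA : fib A} {a b : A} (p : a == b) : b == a :=
  J (fun b _ => b == a) idp p.

(** In diagrammatic order. *)
Definition concat {A : Type} {fA : fib A} {a b c : A} (p : a == b) (q : b == c)
    : a == c :=
  J (fun b _ => b == c -> a == c) (fun q => q) p q.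

Definition happly {A : Type} {B : A -> Type} {fA : fib A}
    {fB : forall a, fib (B a)} {f g : forall a, B a} (p : f == g) (a : A)
    : f a == g a :=
  ap (fun h : forall a, B a => h a) p.

Definition IsContr (A : Type) {fA : fib A} : Type := {c : A & forall x, c == x}.
Definition IsProp (A : Type) {fA : fib A} : Type := forall x y : A, x == y.
Definition IsSet (A : Type) {fA : fib A} : Type := forall x y : A, IsProp (x == y).

Definition fiber {A B : Type} {fA : fib A} {fB : fib B} (f : A -> B) (b : B)
    : Type :=
  {a : A & f a == b}.

Definition IsEquiv {A B : Type} {fA : fib A} {fB : fib B} (f : A -> B) : Type :=
  forall b, IsContr (fiber f b).

Definition Equiv (A B : Type) {fA : fib A} {fB : fib B} : Type :=
  {f : A -> B & IsEquiv f}.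

Definition inv_map {A B : Type} {fA : fib A} {fB : fib B} (e : Equiv A B)
    : B -> A := fun b => (e.2 b).1.1.
End Paths.

Notation "A <~> B" := (Equiv A B) (at level 85, no associativity) : hott_scope.

Ltac path_ind :=
  match goal with
  | |- forall (b : _) (p : @Id ?TT ?T ?fT ?a b), @?P b p =>
      refine (@J TT T fT a P _ _)
  end.

Section PathAlgebra.
Context {TT : TypeTheory}.

Lemma transport_idp {A : Type} {fA : fib A} (B : A -> Type)
    {fB : forall a, fib (B a)} {a : A} (x : B a) : transport B idp x = x.
Proof. unfold transport; now rewrite J_idp. Qed.

Lemma ap_idp {A B : Type} {fA : fib A} {fB : fib B} (f : A -> B) (a : A)
  : ap f (idp (a := a)) = idp.
Proof. unfold ap; now rewrite J_idp. Qed.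

Lemma inverse_idp {A : Type} {fA : fib A} (a : A)
  : inverse (idp (a := a)) = idp.
Proof. unfold inverse; now rewrite J_idp. Qed.

Lemma concat_idp_l {A : Type} {fA : fib A} {a b : A} (p : a == b)
  : concat idp p = p.
Proof. unfold concat; now rewrite J_idp. Qed.

Lemma eq_to_Id {A : Type} {fA : fib A} {a b : A} : a = b -> a == b.
Proof. intros []; exact idp. Qed.

Lemma concat_idp_r {A : Type} {fA : fib A} {a b : A} (p : a == b)
  : concat p idp == p.
Proof.
  revert b p; path_ind; rewrite concat_idp_l; exact idp.
Qed.

Lemma concat_inverse_l {A : Type} {fA : fib A} {a b : A} (p : a == b)
  : concat (inverse p) p == idp.
Proof.
  revert b p; path_ind; rewrite inverse_idp, concat_idp_l; exact idp.
Qed.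

Lemma concat_inverse_r {A : Type} {fA : fib A} {a b : A} (p : a == b)
  : concat p (inverse p) == idp.
Proof.
  revert b p; path_ind; rewrite inverse_idp, concat_idp_l; exact idp.
Qed.

Lemma homotopy_natural {A : Type} {fA : fib A} (h : A -> A)
    (e : forall a, h a == a) {a b : A} (p : a == b)
  : concat (inverse (e a)) (concat (ap h p) (e b)) == p.
Proof.
  revert b p; path_ind; rewrite ap_idp, concat_idp_l.
  apply concat_inverse_l.
Qed.

Lemma ap_compose {A B C : Type} {fA : fib A} {fB : fib B} {fC : fib C}
    (f : A -> B) (g : B -> C) {a b : A} (p : a == b)
  : ap g (ap f p) == ap (fun x => g (f x)) p.
Proof. revert b p; path_ind; rewrite !ap_idp; exact idp. Qed.

Lemma transport_inverse_r {A : Type} {fA : fib A} (B : A -> Type)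
    {fB : forall a, fib (B a)} {a b : A} (p : a == b) (y : B b)
  : transport B p (transport B (inverse p) y) == y.
Proof.
  revert y; revert b p; path_ind; intro y.
  rewrite inverse_idp, !transport_idp; exact idp.
Qed.

Lemma apd {A : Type} {fA : fib A} {B : A -> Type} {fB : forall a, fib (B a)}
    (f : forall a, B a) {a b : A} (p : a == b) : transport B p (f a) == f b.
Proof. revert b p; path_ind; rewrite transport_idp; exact idp. Qed.

Definition path_sig {A : Type} {B : A -> Type} {fA : fib A}
    {fB : forall a, fib (B a)} (u v : {a : A & B a}) (p : u.1 == v.1)
    (q : transport B p u.2 == v.2) : u == v.
Proof.
  destruct u as [a x], v as [b y]; cbn in p, q.
  revert y q; revert b p; path_ind; intro y; rewrite transport_idp.
  revert y; path_ind; exact idp.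
Qed.

Lemma path_sig_idp {A : Type} {B : A -> Type} {fA : fib A}
    {fB : forall a, fib (B a)} (a : A) (x y : B a) (q : x == y)
  : (a; x) == (a; y) :> {a : A & B a}.
Proof. exact (ap (fun z => (a; z)) q). Qed.

Lemma path_sig_prop {A : Type} {B : A -> Type} {fA : fib A}
    {fB : forall a, fib (B a)} (hB : forall a, IsProp (B a))
    (u v : {a : A & B a}) (p : u.1 == v.1) : u == v.
Proof. exact (path_sig u v p (hB _ _ _)). Qed.

Lemma isprop_iscontr {A : Type} {fA : fib A} : IsContr A -> IsProp A.
Proof. intros c x y; exact (concat (inverse (c.2 x)) (c.2 y)). Qed.

Lemma iscontr_prop_path {A : Type} {fA : fib A} (h : IsProp A) (x y : A)
  : IsContr (x == y).
Proof.
  exists (concat (inverse (h x x)) (h x y)).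
  revert y; path_ind; apply concat_inverse_l.
Qed.

Lemma isset_isprop {A : Type} {fA : fib A} : IsProp A -> IsSet A.
Proof. intros h x y; apply isprop_iscontr, iscontr_prop_path, h. Qed.

Lemma iscontr_retract {A B : Type} {fA : fib A} {fB : fib B} (s : A -> B)
    (r : B -> A) (e : forall a, r (s a) == a) : IsContr B -> IsContr A.
Proof.
  intro c; exists (r c.1); intro a.
  exact (concat (ap r (c.2 (s a))) (e a)).
Qed.

Lemma isprop_retract {A B : Type} {fA : fib A} {fB : fib B} (s : A -> B)
    (r : B -> A) (e : forall a, r (s a) == a) : IsProp B -> IsProp A.
Proof.
  intros h x y.
  exact (concat (inverse (e x)) (concat (ap r (h (s x) (s y))) (e y))).
Qed.

Lemma iscontr_singleton {A : Type} {fA : fib A} (a : A)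
  : IsContr {b : A & a == b}.
Proof.
  exists (a; idp); intros [b p]; revert b p; path_ind; exact idp.
Qed.

Lemma inverse_inverse {A : Type} {fA : fib A} {a b : A} (p : a == b)
  : inverse (inverse p) == p.
Proof. revert b p; path_ind; rewrite !inverse_idp; exact idp. Qed.

Lemma iscontr_singleton' {A : Type} {fA : fib A} (a : A)
  : IsContr {b : A & b == a}.
Proof.
  refine (iscontr_retract
    (fun u : {b : A & b == a} => existT (fun b => a == b) u.1 (inverse u.2))
    (fun u => existT (fun b => b == a) u.1 (inverse u.2)) _
    (iscontr_singleton a)).
  intros [b p]; apply path_sig_idp, inverse_inverse.
Qed.

Lemma concat_cancel {A : Type} {fA : fib A} {a b c : A} (p : a == b)
    (q : b == c) : concat (inverse p) (concat p q) == q.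
Proof.
  revert q; revert b p; path_ind; intro q.
  rewrite inverse_idp, !concat_idp_l; exact idp.
Qed.

Lemma concat_cancel' {A : Type} {fA : fib A} {a b c : A} (p : a == b)
    (q : a == c) : concat p (concat (inverse p) q) == q.
Proof.
  revert q; revert b p; path_ind; intro q.
  rewrite inverse_idp, !concat_idp_l; exact idp.
Qed.

Lemma isequiv_qinv {A B : Type} {fA : fib A} {fB : fib B} (f : A -> B)
    (g : B -> A) (fg : forall b, f (g b) == b) (gf : forall a, g (f a) == a)
  : IsEquiv f.
Proof.
  intro b.
  refine (iscontr_retract
    (fun u : fiber f b => existT (fun a => g (f a) == g b) u.1 (ap g u.2))
    (fun u => existT (fun a => f a == b) u.1
      (concat (inverse (fg (f u.1))) (concat (ap f u.2) (fg b)))) _ _).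
  - intros [a p]; apply path_sig_idp; cbn.
    refine (concat (ap (fun q => concat _ (concat q (fg b)))
      (ap_compose g f p)) _).
    exact (homotopy_natural (fun b => f (g b)) fg p).
  - refine (iscontr_retract
      (fun u : {a : A & g (f a) == g b} =>
        existT (fun a => a == g b) u.1 (concat (inverse (gf u.1)) u.2))
      (fun u => existT (fun a => g (f a) == g b) u.1 (concat (gf u.1) u.2)) _
      (iscontr_singleton' (g b))).
    intros [a p]; apply path_sig_idp, concat_cancel'.
Qed.

Lemma inv_map_r {A B : Type} {fA : fib A} {fB : fib B} (e : A <~> B) (b : B)
  : e.1 (inv_map e b) == b.
Proof. exact (e.2 b).1.2. Defined.

Lemma inv_map_l_aux {A B : Type} {fA : fib A} {fB : fib B} (f : A -> B)
    {b : B} {u v : fiber f b} (q : u == v)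
  : concat (ap f (ap (fun w => w.1) q)) v.2 == u.2.
Proof.
  revert v q; path_ind.
  rewrite !ap_idp, concat_idp_l; exact idp.
Qed.

Definition inv_map_l {A B : Type} {fA : fib A} {fB : fib B} (e : A <~> B)
    (a : A) : inv_map e (e.1 a) == a :=
  ap (fun w => w.1) ((e.2 (e.1 a)).2 (existT (fun x => e.1 x == e.1 a) a idp)).

Lemma inv_map_triangle {A B : Type} {fA : fib A} {fB : fib B} (e : A <~> B)
    (a : A) : ap e.1 (inv_map_l e a) == inv_map_r e (e.1 a).
Proof.
  refine (concat (inverse (concat_idp_r _)) _).
  exact (inv_map_l_aux e.1 ((e.2 (e.1 a)).2 (existT (fun x => e.1 x == e.1 a) a idp))).
Qed.

Definition equiv_id (A : Type) {fA : fib A} : A <~> A :=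
  (fun a => a; isequiv_qinv (fun a => a) (fun a => a) (fun _ => idp)
    (fun _ => idp)).

Definition equiv_inverse {A B : Type} {fA : fib A} {fB : fib B} (e : A <~> B)
    : B <~> A :=
  (inv_map e; isequiv_qinv (inv_map e) e.1 (inv_map_l e) (inv_map_r e)).

Lemma isequiv_compose {A B C : Type} {fA : fib A} {fB : fib B} {fC : fib C}
    (e : A <~> B) (e' : B <~> C) : IsEquiv (fun a => e'.1 (e.1 a)).
Proof.
  refine (isequiv_qinv _ (fun c => inv_map e (inv_map e' c)) _ _).
  - intro c; exact (concat (ap e'.1 (inv_map_r e _)) (inv_map_r e' c)).
  - intro a; exact (concat (ap (inv_map e) (inv_map_l e' _)) (inv_map_l e a)).
Qed.

Definition equiv_compose {A B C : Type} {fA : fib A} {fB : fib B} {fC : fib C}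
    (e : A <~> B) (e' : B <~> C) : A <~> C :=
  (fun a => e'.1 (e.1 a); isequiv_compose e e').

Lemma isprop_equiv {A B : Type} {fA : fib A} {fB : fib B} (e : A <~> B)
  : IsProp B -> IsProp A.
Proof. exact (isprop_retract e.1 (inv_map e) (inv_map_l e)). Qed.

(** The fundamental theorem of identity types. *)
Lemma isequiv_from_Id {A : Type} {fA : fib A} {a : A} {R : A -> Type}
    {fR : forall b, fib (R b)} (g : forall b, a == b -> R b)
    (c : IsContr {b : A & R b}) (b : A) : IsEquiv (g b).
Proof.
  pose (u0 := (a; g a idp) : {b : A & R b}).
  pose (q := fun u => concat (inverse (c.2 u0)) (c.2 u)).
  assert (G : forall u (p : u0 == u), g u.1 (ap (fun w => w.1) p) == u.2).
  { path_ind; rewrite ap_idp; exact idp. }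
  refine (isequiv_qinv (g b) (fun r => ap (fun w => w.1) (q (b; r))) _ _).
  - intro r; exact (G (b; r) (q (b; r))).
  - revert b; path_ind.
    refine (concat (ap _ (concat_inverse_l _)) _).
    rewrite ap_idp; exact idp.
Qed.

Lemma isequiv_ap {A B : Type} {fA : fib A} {fB : fib B} (e : A <~> B) (a b : A)
  : IsEquiv (fun p : a == b => ap e.1 p).
Proof.
  refine (isequiv_from_Id (R := fun b => e.1 a == e.1 b)
    (fun b p => ap e.1 p) _ b).
  refine (iscontr_retract
    (fun u : {b : A & e.1 a == e.1 b} =>
      existT (fun b => e.1 b == e.1 a) u.1 (inverse u.2))
    (fun u => existT (fun b => e.1 a == e.1 b) u.1 (inverse u.2)) _
    (e.2 (e.1 a))).
  intros [x p]; apply path_sig_idp, inverse_inverse.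
Qed.

Definition sig_code {A : Type} {B : A -> Type} {fA : fib A}
    {fB : forall a, fib (B a)} (u v : {a : A & B a}) (p : u == v)
    : {q : u.1 == v.1 & transport B q u.2 == v.2} :=
  J (fun v _ => {q : u.1 == v.1 & transport B q u.2 == v.2})
    (idp; eq_to_Id (transport_idp B u.2)) p.

Lemma isequiv_sig_code {A : Type} {B : A -> Type} {fA : fib A}
    {fB : forall a, fib (B a)} (u v : {a : A & B a})
  : IsEquiv (sig_code u v).
Proof.
  refine (isequiv_from_Id (sig_code u) _ v).
  unshelve refine (existT _ (existT _ (u.1; transport B idp u.2) _) _);
    [exists idp; exact idp |].
  intros [[b y] [p q]]; cbn in p, q.
  revert y q; revert b p; path_ind; path_ind; exact idp.
Qed.

Definition equiv_sig_code {A : Type} {B : A -> Type} {fA : fib A}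
    {fB : forall a, fib (B a)} (u v : {a : A & B a})
    : (u == v) <~> {q : u.1 == v.1 & transport B q u.2 == v.2} :=
  (sig_code u v; isequiv_sig_code u v).

Lemma isequiv_sig_prop {A A' : Type} {fA : fib A} {fA' : fib A'}
    {B : A -> Type} {fB : forall a, fib (B a)}
    {B' : A' -> Type} {fB' : forall a, fib (B' a)}
    (hB : forall a, IsProp (B a)) (hB' : forall a, IsProp (B' a))
    (e : A <~> A') (g : forall a, B a -> B' (e.1 a))
    (h : forall a, B' (e.1 a) -> B a)
  : IsEquiv (fun u : {a : A & B a} => (e.1 u.1; g u.1 u.2) : {a : A' & B' a}).
Proof.
  refine (isequiv_qinv _ (fun v : {a : A' & B' a} => (inv_map e v.1;
    h _ (transport B' (inverse (inv_map_r e v.1)) v.2))) _ _).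
  - intro v; apply (path_sig_prop hB'), inv_map_r.
  - intro u; apply (path_sig_prop hB), inv_map_l.
Qed.

Lemma equiv_sig {A A' : Type} {fA : fib A} {fA' : fib A'}
    {B : A -> Type} {fB : forall a, fib (B a)}
    {B' : A' -> Type} {fB' : forall a, fib (B' a)}
    (e : A <~> A') (g : forall a, B a <~> B' (e.1 a))
  : {a : A & B a} <~> {a : A' & B' a}.
Proof.
  exists (fun u => (e.1 u.1; (g u.1).1 u.2)).
  refine (isequiv_qinv _ (fun v : {a : A' & B' a} => (inv_map e v.1;
    inv_map (g _) (transport B' (inverse (inv_map_r e v.1)) v.2))) _ _).
  - intros [a' y]; cbn.
    apply (path_sig (_; _) (_; _) (inv_map_r e a')); cbn.
    refine (concat (ap _ (inv_map_r (g _) _)) _).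
    apply transport_inverse_r.
  - intros [a x]; cbn.
    apply (path_sig (_; _) (_; _) (inv_map_l e a)); cbn.
    refine (concat (ap (fun p => transport B _ (inv_map (g _)
      (transport B' (inverse p) _))) (inverse (inv_map_triangle e a))) _).
    assert (K : forall b c (p : b == c) (y : B c), transport B p
      (inv_map (g b) (transport B' (inverse (ap e.1 p)) ((g c).1 y))) == y).
    { intro b; path_ind; intro y.
      rewrite ap_idp, inverse_idp, !transport_idp; apply inv_map_l. }
    apply K.
Qed.
End PathAlgebra.

Class FunctionExtensionality {TT : TypeTheory} :=
  isequiv_happly : forall (A : Type) (B : A -> Type) (fA : fib A)
    (fB : forall a, fib (B a)) (f g : forall a, B a),
    IsEquiv (fun p : f == g => happly p).

Class SetTruncation {TT : TypeTheory} := {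
  Trunc0 : forall (A : Type) {fA : fib A}, Type;
  fib_Trunc0 : forall (A : Type) {fA : fib A}, fib (Trunc0 A);
  tr : forall {A : Type} {fA : fib A}, A -> Trunc0 A;
  isset_Trunc0 : forall (A : Type) {fA : fib A},
    @IsSet TT (Trunc0 A) (fib_Trunc0 A);
  Trunc0_ind : forall {A : Type} {fA : fib A} (P : Trunc0 A -> Type)
    {fP : forall x, fib (P x)},
    (forall x, IsSet (P x)) -> (forall a, P (tr a)) -> forall x, P x;
  Trunc0_ind_tr : forall {A : Type} {fA : fib A} (P : Trunc0 A -> Type)
    {fP : forall x, fib (P x)} (hP : forall x, IsSet (P x))
    (f : forall a, P (tr a)) (a : A), Trunc0_ind P hP f (tr a) = f a
}.

#[global] Existing Instance fib_Trunc0.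

Definition idtoequiv {TT : TypeTheory} {U : Type} {fU : fib U}
    (El : U -> Type) {fEl : forall X, fib (El X)} (X Y : U) (p : X == Y)
    : El X <~> El Y :=
  J (fun Y _ => El X <~> El Y) (equiv_id (El X)) p.

(** A Tarski universe.  Codes for the type formers are only required to decode
    up to equivalence. *)
Class UnivalentUniverse {TT : TypeTheory} {ST : SetTruncation} := {
  U : Type;
  fib_U : fib U;
  El : U -> Type;
  fib_El : forall X, fib (El X);
  univalence : forall X Y : U, IsEquiv (idtoequiv El X Y);
  U_forall : forall (X : U) (Y : El X -> U),
    {Z : U & El Z <~> forall x, El (Y x)};
  U_sig : forall (X : U) (Y : El X -> U), {Z : U & El Z <~> {x : El X & El (Y x)}};
  U_Id : forall (X : U) (x y : El X), {Z : U & El Z <~> (x == y)};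
  U_Trunc0 : forall X : U, {Z : U & El Z <~> Trunc0 (El X)}
}.

#[global] Existing Instances fib_U fib_El.

Section Consequences.
Context {TT : TypeTheory} {FE : FunctionExtensionality} {ST : SetTruncation}
  {UU : UnivalentUniverse}.

Definition path_forall {A : Type} {B : A -> Type} {fA : fib A}
    {fB : forall a, fib (B a)} (f g : forall a, B a) (h : forall a, f a == g a)
    : f == g :=
  inv_map (existT _ _ (isequiv_happly A B fA fB f g)) h.

Definition equiv_path (X Y : U) : (X == Y) <~> (El X <~> El Y) :=
  existT _ _ (univalence X Y).

Definition ua {X Y : U} (e : El X <~> El Y) : X == Y :=
  inv_map (equiv_path X Y) e.

Lemma idtoequiv_idp (X : U) : idtoequiv El X X idp = equiv_id (El X).
Proof. unfold idtoequiv; now rewrite J_idp. Qed.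

Lemma isprop_forall {A : Type} {B : A -> Type} {fA : fib A}
    {fB : forall a, fib (B a)} (h : forall a, IsProp (B a))
  : IsProp (forall a, B a).
Proof. intros f g; apply path_forall; intro a; apply h. Qed.

Lemma isprop_sig {A : Type} {B : A -> Type} {fA : fib A}
    {fB : forall a, fib (B a)} (hA : IsProp A) (hB : forall a, IsProp (B a))
  : IsProp {a : A & B a}.
Proof. intros u v; apply (path_sig_prop hB), hA. Qed.

Lemma isprop_IsContr {A : Type} {fA : fib A} : IsProp (IsContr A).
Proof.
  intros c d.
  refine (path_sig_prop (fun a => _) c d (c.2 d.1)).
  apply isprop_forall; intro x.
  apply isset_isprop, isprop_iscontr, c.
Qed.

Lemma isprop_IsEquiv {A B : Type} {fA : fib A} {fB : fib B} (f : A -> B)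
  : IsProp (IsEquiv f).
Proof. apply isprop_forall; intro b; apply isprop_IsContr. Qed.

Lemma path_equiv {A B : Type} {fA : fib A} {fB : fib B} (e e' : A <~> B)
  : e.1 == e'.1 -> e == e'.
Proof. apply path_sig_prop; intro f; apply isprop_IsEquiv. Qed.

Lemma isprop_Equiv {A B : Type} {fA : fib A} {fB : fib B}
  : IsProp B -> IsProp (A <~> B).
Proof.
  intros h e e'; apply path_equiv, path_forall; intro a; apply h.
Qed.

Definition IsSmall (T : Type) {fT : fib T} : Type := {S : U & El S <~> T}.

Lemma small_equiv {T T' : Type} {fT : fib T} {fT' : fib T'} (e : T <~> T')
  : IsSmall T -> IsSmall T'.
Proof. intro s; exact (s.1; equiv_compose s.2 e). Qed.

Lemma small_El (X : U) : IsSmall (El X).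
Proof. exact (X; equiv_id _). Qed.

Lemma small_sig {A : Type} {B : A -> Type} {fA : fib A}
    {fB : forall a, fib (B a)}
  : IsSmall A -> (forall a, IsSmall (B a)) -> IsSmall {a : A & B a}.
Proof.
  intros s t.
  refine (small_equiv _ (U_sig s.1 (fun x => (t (s.2.1 x)).1))).
  exact (equiv_sig s.2 (fun x => (t (s.2.1 x)).2)).
Qed.

Lemma equiv_forall {A A' : Type} {fA : fib A} {fA' : fib A'}
    {B : A -> Type} {fB : forall a, fib (B a)}
    {B' : A' -> Type} {fB' : forall a, fib (B' a)}
    (e : A <~> A') (g : forall a, B a <~> B' (e.1 a))
  : (forall a, B a) <~> (forall a', B' a').
Proof.
  exists (fun k a' => transport B' (inv_map_r e a') ((g _).1 (k (inv_map e a')))).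
  refine (isequiv_qinv _ (fun k a => inv_map (g a) (k (e.1 a))) _ _).
  - intro k; apply path_forall; intro a'; cbn.
    refine (concat (ap (transport B' _) (inv_map_r (g _) _)) _).
    apply apd.
  - intro k; apply path_forall; intro a; cbn.
    refine (concat (ap (fun p => inv_map (g a) (transport B' p _))
      (inverse (inv_map_triangle e a))) _).
    assert (K : forall b c (p : b == c), inv_map (g c)
      (transport B' (ap e.1 p) ((g b).1 (k b))) == k c).
    { intro b; path_ind; rewrite ap_idp, transport_idp; apply inv_map_l. }
    apply K.
Qed.

Lemma small_forall {A : Type} {B : A -> Type} {fA : fib A}
    {fB : forall a, fib (B a)}
  : IsSmall A -> (forall a, IsSmall (B a)) -> IsSmall (forall a, B a).
Proof.
  intros s t.
  refine (small_equiv _ (U_forall s.1 (fun x => (t (s.2.1 x)).1))).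
  exact (equiv_forall s.2 (fun x => (t (s.2.1 x)).2)).
Qed.

Lemma small_Id {A : Type} {fA : fib A} (s : IsSmall A) (a b : A)
  : IsSmall (a == b).
Proof.
  pose (e := equiv_inverse s.2).
  refine (small_equiv (equiv_inverse _) (U_Id s.1 (e.1 a) (e.1 b))).
  exact (existT _ _ (isequiv_ap e a b)).
Qed.

Definition Trunc0_rec {A B : Type} {fA : fib A} {fB : fib B} (hB : IsSet B)
    (f : A -> B) : Trunc0 A -> B :=
  Trunc0_ind (fun _ => B) (fun _ => hB) f.

Definition Trunc0_map {A B : Type} {fA : fib A} {fB : fib B} (f : A -> B)
    : Trunc0 A -> Trunc0 B :=
  Trunc0_rec (isset_Trunc0 B) (fun a => tr (f a)).

Lemma Trunc0_map_tr {A B : Type} {fA : fib A} {fB : fib B} (f : A -> B) (a : A)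
  : Trunc0_map f (tr a) = tr (f a).
Proof. exact (Trunc0_ind_tr _ _ _ a). Qed.

Lemma tr_ap {A B : Type} {fA : fib A} {fB : fib B} (f : A -> B) {a b : A}
  : tr a == tr b -> tr (f a) == tr (f b).
Proof.
  intro p; rewrite <- (Trunc0_map_tr f a), <- (Trunc0_map_tr f b).
  exact (ap (Trunc0_map f) p).
Qed.

Lemma small_Trunc0 {A : Type} {fA : fib A}
  : IsSmall A -> IsSmall (Trunc0 A).
Proof.
  intro s; refine (small_equiv _ (U_Trunc0 s.1)).
  exists (Trunc0_map s.2.1).
  refine (isequiv_qinv _ (Trunc0_map (inv_map s.2)) _ _);
    (refine (Trunc0_ind _ _ _);
      [intro x; apply isset_isprop, isset_Trunc0
      |intro a; rewrite !Trunc0_map_tr; refine (ap tr _)]).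
  - apply inv_map_r.
  - apply inv_map_l.
Qed.

(** Propositions only see the set truncation. *)
Lemma transport_tr {A : Type} {fA : fib A} (P : A -> Type)
    {fP : forall a, fib (P a)} (hP : forall a, IsProp (P a))
    (s : forall a, IsSmall (P a)) {a b : A}
  : tr a == tr b -> P a -> P b.
Proof.
  pose (HProp := {X : U & IsProp (El X)}).
  assert (hH : IsSet HProp).
  { intros X Y.
    refine (isprop_equiv (equiv_sig_code X Y) _).
    apply isprop_sig.
    - refine (isprop_equiv (equiv_path X.1 Y.1) (isprop_Equiv Y.2)).
    - intro q; apply isset_isprop.
      apply isprop_forall; intro x; apply isprop_forall; intro y.
      apply isset_isprop, Y.2. }
  pose (Q := Trunc0_rec hH (fun a => existT (fun X => IsProp (El X)) (s a).1
    (isprop_equiv (s a).2 (hP a)))).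
  intros p x.
  apply ((s b).2.1).
  pose proof (fun c => Trunc0_ind_tr (fun _ => HProp) (fun _ => hH)
    (fun a => existT (fun X => IsProp (El X)) (s a).1
      (isprop_equiv (s a).2 (hP a))) c) as E.
  pose (q := ap (fun X : HProp => X.1) (ap Q p)).
  unfold Q, Trunc0_rec in q; rewrite !E in q.
  exact (transport El q (inv_map (s a).2 x)).
Qed.

Definition Trunc0_concat {A : Type} {fA : fib A} {a b c : A}
    (p : Trunc0 (a == b)) (q : Trunc0 (b == c)) : Trunc0 (a == c) :=
  Trunc0_rec (isset_Trunc0 _) (fun p => Trunc0_map (concat p) q) p.
End Consequences.

Section Structures.
Context {TT : TypeTheory} {ST : SetTruncation}.

(** The component [T_(t)] of [t] in [T]. *)
Definition component (T : Type) {fT : fib T} (t : T) : Type :=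
  {t' : T & tr t' == tr t}.

Definition ev {T : Type} {fT : fib T} (pt : T) (f : component (T -> T) (fun x => x))
    : T :=
  f.1 pt.

Definition IsCentral (T : Type) {fT : fib T} (pt : T) : Type := IsEquiv (ev pt).

Record IsHSpace (T : Type) {fT : fib T} (pt : T) (mu : T -> T -> T) : Type := {
  hspace_l : forall a, mu pt a == a;
  hspace_r : forall a, mu a pt == a;
  hspace_lr : hspace_l pt == hspace_r pt
}.

Definition IsAbelian (T : Type) {fT : fib T} (mu : T -> T -> T) : Type :=
  forall a b, mu a b == mu b a.
End Structures.

Section Central.
Context {TT : TypeTheory} {FE : FunctionExtensionality} {ST : SetTruncation}
  {UU : UnivalentUniverse} {A : U} {pt : El A} (cA : IsCentral (El A) pt).

Definition ev_equiv : component (El A -> El A) (fun x => x) <~> El A :=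
  (ev pt; cA).

Lemma small_IsEquiv (X Y : U) (f : El X -> El Y) : IsSmall (IsEquiv f).
Proof.
  apply small_forall; [apply small_El | intro y].
  assert (s : IsSmall (fiber f y)).
  { apply small_sig; [apply small_El | intro; apply small_Id, small_El]. }
  apply small_sig; [exact s | intro; apply small_forall; [exact s | intro]].
  apply small_Id, s.
Qed.

Lemma small_Equiv (X Y : U) : IsSmall (El X <~> El Y).
Proof.
  apply small_sig; [| apply small_IsEquiv].
  apply small_forall; intros; apply small_El.
Qed.

Lemma isequiv_component (f : El A -> El A)
  : tr f == tr (fun x : El A => x) -> IsEquiv f.
Proof.
  intro p.
  refine (transport_tr IsEquiv isprop_IsEquiv (small_IsEquiv A A) (inverse p) _).
  exact (equiv_id (El A)).2.
Qed.

(** The H-space structure of a central type: [a . -] is the map in the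
    component of the identity which sends [pt] to [a]. *)
Definition mul (a b : El A) : El A := (inv_map ev_equiv a).1 b.

Lemma mul_IsHSpace : IsHSpace (El A) pt mul.
Proof.
  pose (i := existT (fun f => tr f == tr (fun x : El A => x)) (fun x => x) idp).
  exists (fun b => ap (fun f => f.1 b) (inv_map_l ev_equiv i))
    (inv_map_r ev_equiv).
  exact (inv_map_triangle ev_equiv i).
Qed.

Definition equiv_mul (a : El A) : El A <~> El A :=
  (mul a; isequiv_component _ (inv_map ev_equiv a).2).

(** The inversion [a^* := (a . -)^-1 (pt)]. *)
Definition id_star (a : El A) : El A := inv_map (equiv_mul a) pt.

Lemma tr_central (a : El A) : tr a == tr pt.
Proof.
  refine (concat (ap tr (inverse (inv_map_r ev_equiv a))) _).
  exact (tr_ap (fun f => f pt) (inv_map ev_equiv a).2).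
Qed.

Lemma isequiv_mul_r (b : El A) : IsEquiv (fun a => mul a b).
Proof.
  apply isequiv_component.
  refine (concat (tr_ap (fun b a => mul a b) (tr_central b)) _).
  refine (ap tr (path_forall _ _ _)).
  apply mul_IsHSpace.
Qed.

Lemma isequiv_id_star : IsEquiv id_star.
Proof.
  pose (r := fun b => existT _ _ (isequiv_mul_r b) : El A <~> El A).
  assert (H : forall a b, mul a b == pt -> inv_map (r b) pt == a).
  { intros a b p.
    exact (concat (ap (inv_map (r b)) (inverse p)) (inv_map_l (r b) a)). }
  assert (H' : forall a b, mul a b == pt -> id_star a == b).
  { intros a b p.
    refine (concat _ (inv_map_l (equiv_mul a) b)).
    exact (ap (inv_map (equiv_mul a)) (inverse p)). }
  refine (isequiv_qinv id_star (fun b => inv_map (r b) pt) _ _).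
  - intro b; apply H'; exact (inv_map_r (r b) pt).
  - intro a; apply H; exact (inv_map_r (equiv_mul a) pt).
Qed.

Definition refl_star : A == A := ua (id_star; isequiv_id_star).

Definition BAut1 : Type := {X : U & Trunc0 (A == X)}.

Definition BAut1_pt : BAut1 := (A; tr idp).

Definition dual (x : BAut1) : BAut1 := (x.1; Trunc0_concat (tr refl_star) x.2).

Lemma small_BAut1_Id (x y : BAut1) : IsSmall (x == y).
Proof.
  assert (s : forall X Y : U, IsSmall (X == Y)).
  { intros X Y; refine (small_equiv (equiv_inverse (equiv_path X Y)) _).
    apply small_Equiv. }
  refine (small_equiv (equiv_inverse (equiv_sig_code x y)) _).
  apply small_sig; [apply s | intro; apply small_Id, small_Trunc0, s].
Qed.

(** Bands live over types in the universe [U], whereas [x == y] is only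
    essentially small: [BAut1_Id x y] is its replacement in [U]. *)
Definition BAut1_Id (x y : BAut1) : U := (small_BAut1_Id x y).1.

Definition equiv_BAut1_Id (x y : BAut1) : El (BAut1_Id x y) <~> (x == y) :=
  (small_BAut1_Id x y).2.

Lemma transport_band {X Y : U} (q : X == Y)
  : transport (fun Y => Trunc0 (X == Y)) q (tr idp) == tr q.
Proof. revert Y q; path_ind; rewrite transport_idp; exact idp. Qed.

Lemma loop_component (q : A == A)
  : transport (fun X => Trunc0 (A == X)) q (tr idp) == tr idp ->
    tr ((equiv_path A A).1 q) == tr (equiv_id (El A)).
Proof.
  intro h.
  refine (concat (tr_ap (equiv_path A A).1
    (concat (inverse (transport_band q)) h)) _).
  apply (ap tr), eq_to_Id, idtoequiv_idp.
Qed.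

Lemma component_loop (q : A == A)
  : tr ((equiv_path A A).1 q) == tr (equiv_id (El A)) ->
    transport (fun X => Trunc0 (A == X)) q (tr idp) == tr idp.
Proof.
  intro h; refine (concat (transport_band q) _).
  refine (concat (ap tr (inverse (inv_map_l (equiv_path A A) q))) _).
  refine (concat (tr_ap (inv_map (equiv_path A A)) h) (ap tr _)).
  refine (concat _ (inv_map_l (equiv_path A A) idp)).
  apply ap, eq_to_Id; symmetry; apply idtoequiv_idp.
Qed.

Definition equiv_loops
    : (BAut1_pt == BAut1_pt) <~> component (El A <~> El A) (equiv_id (El A)) :=
  equiv_compose (equiv_sig_code BAut1_pt BAut1_pt)
    (existT _ _ (isequiv_sig_prop
      (B := fun q => transport (fun X => Trunc0 (A == X)) q (tr idp) == tr idp)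
      (B' := fun e => tr e == tr (equiv_id (El A)))
      (fun _ => isset_Trunc0 _ _ _) (fun _ => isset_Trunc0 _ _ _)
      (equiv_path A A) loop_component component_loop)).

Definition ev_auts (f : component (El A <~> El A) (equiv_id (El A))) : El A :=
  f.1.1 pt.

Lemma isequiv_ev_auts : IsEquiv ev_auts.
Proof.
  assert (H : forall a, tr (equiv_mul a) == tr (equiv_id (El A))).
  { intro a.
    refine (transport_tr
      (fun f => forall h : IsEquiv f, tr (f; h) == tr (equiv_id (El A))) _ _
      (inverse (inv_map ev_equiv a).2) _ _).
    - intro f; apply isprop_forall; intro h; apply isset_Trunc0.
    - intro f; apply small_forall; [apply small_IsEquiv | intro h].
      apply small_Id, small_Trunc0, small_Equiv.
    - intro h; apply (ap tr), path_equiv; exact idp. }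
  refine (isequiv_qinv ev_auts (fun a => (equiv_mul a; H a)) _ _).
  - exact (inv_map_r ev_equiv).
  - intro f; refine (path_sig_prop (fun _ => isset_Trunc0 _ _ _) _ _ _).
    apply path_equiv.
    exact (ap (fun w => w.1)
      (inv_map_l ev_equiv (f.1.1; tr_ap (fun e => e.1) f.2))).
Qed.

(** A loop acts on [A]; it is determined by where that action sends [pt]. *)
Definition equiv_loops_ev : (BAut1_pt == BAut1_pt) <~> El A :=
  equiv_compose equiv_loops (ev_auts; isequiv_ev_auts).

Definition band_pt : Trunc0 (A == BAut1_Id BAut1_pt BAut1_pt) :=
  tr (ua (equiv_compose (equiv_inverse equiv_loops_ev)
    (equiv_inverse (equiv_BAut1_Id BAut1_pt BAut1_pt)))).

Definition band (x y : BAut1) : Trunc0 (A == BAut1_Id x y) :=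
  match x, y with
  | (X; p), (Y; q) =>
      Trunc0_ind (fun p => Trunc0 (A == BAut1_Id (X; p) (Y; q)))
        (fun _ => isset_Trunc0 _)
        (fun r => J (fun X r => Trunc0 (A == BAut1_Id (X; tr r) (Y; q)))
          (Trunc0_ind (fun q => Trunc0 (A == BAut1_Id BAut1_pt (Y; q)))
            (fun _ => isset_Trunc0 _)
            (fun s => J (fun Y s => Trunc0 (A == BAut1_Id BAut1_pt (Y; tr s)))
              band_pt s)
            q)
          r)
        p
  end.

Definition tensor (x y : BAut1) : BAut1 :=
  (BAut1_Id (dual x) y; band (dual x) y).
End Central.

Arguments BAut1 {TT ST UU} A.
Arguments BAut1_pt {TT ST UU} A.

(* Main.v *)
Require Import Defs.

Local Open Scope hott_scope.

(** A path between [A]-bands is an equivalence of the underlying types that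
    respects the bands.  Whether an equivalence respects bands is a proposition,
    and [BAut1 A] is connected, so for a family of equivalences this need only
    be checked at the base point [pt].  Both the commutativity of the tensor
    product and its left unit law are obtained in this way, from equivalences
    that are defined for all bands at once.

    For commutativity the equivalence [X^* = Y] to [Y^* = X] inverts the dual of
    a path and uses that the dual is an involution ([swap]).  For the left unit
    law the equivalence [pt^* = X] to [X] is the action of a path on the base
    point of [A] ([ev_path]).

    At the base point everything can be computed, because a path in [BAut1 A] is
    determined by the map [act] that it induces on underlying types
    ([path_act]).  The loop that corresponds to [a : A] acts as [a . -]
    ([act_loop]), and there is a path from [pt] to [pt^*] that acts as the
    inversion ([path_pt_dual]).  Hence the band of [pt^* = pt] is represented
    by the equivalence [star_path] sending [a] to a path that acts as
    [b |-> a . b^*] ([act_star_path]).  The map [swap] inverts actions, so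
    commutativity amounts to [b |-> a . b^*] being an involution
    ([mul_star_involutive]); and the left unit law amounts to [a . pt^*] being
    [a].  Identities of this kind hold in a central type because two self-maps
    in the component of the identity agree as soon as they agree at [pt]
    ([central_ext]).

    The right unit law follows by commutativity.  The coherence between the two
    unit laws costs nothing: any pair of unit laws can be made coherent by
    changing the right one ([IsHSpace_of_units]).  *)

(** * Coherence of unit laws *)

Section HSpaces.
Context {TT : TypeTheory}.

Lemma concat_assoc {T : Type} {fT : fib T} {a b c d : T} (p : a == b)
    (q : b == c) (r : c == d)
  : concat p (concat q r) == concat (concat p q) r.
Proof.
  revert q r; revert b p; path_ind; intros q r.
  rewrite !concat_idp_l; exact idp.
Qed.

Lemma concat_cancel_r {T : Type} {fT : fib T} {a b c : T} (p q : a == b)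
    (r : b == c) : concat p r == concat q r -> p == q.
Proof.
  revert c r; path_ind; intro h.
  exact (concat (inverse (concat_idp_r p)) (concat h (concat_idp_r q))).
Qed.

Lemma ap_homotopy_id {T : Type} {fT : fib T} (h : T -> T)
    (e : forall a, h a == a) {a b : T} (p : a == b)
  : concat (ap h p) (e b) == concat (e a) p.
Proof.
  refine (concat (inverse (concat_cancel' (e a) _)) _).
  exact (ap (concat (e a)) (homotopy_natural h e p)).
Qed.

(** The right unit law is changed, at each [a], by the image under [mu a] of the
    loop [v] that measures the difference between [r pt] and [l pt].  At
    [a := pt] the new law is [ap (mu pt) v] followed by [r pt]; composing it
    with [v] gives [ap (mu pt) v] followed by [l pt], which by naturality of
    [l] is [l pt] followed by [v]. *)
Lemma IsHSpace_of_units {T : Type} {fT : fib T} (pt : T) (mu : T -> T -> T)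
    (l : forall a, mu pt a == a) (r : forall a, mu a pt == a)
  : IsHSpace T pt mu.
Proof.
  pose (v := concat (inverse (r pt)) (l pt)).
  exists l (fun a => concat (ap (mu a) v) (r a)).
  apply (concat_cancel_r _ _ v).
  refine (inverse (concat (inverse (concat_assoc _ _ _)) _)).
  refine (concat (ap (concat _) (concat_cancel' (r pt) (l pt))) _).
  exact (ap_homotopy_id (mu pt) l v).
Qed.
End HSpaces.

(** * Paths between bands *)

Section BandedPaths.
Context {TT : TypeTheory} {FE : FunctionExtensionality} {ST : SetTruncation}
  {UU : UnivalentUniverse}.

Lemma equiv_inj {S T : Type} {fS : fib S} {fT : fib T} (e : S <~> T) {a b : S}
  : e.1 a == e.1 b -> a == b.
Proof.
  intro p.
  refine (concat (inverse (inv_map_l e a)) (concat _ (inv_map_l e b))).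
  exact (ap (inv_map e) p).
Qed.

Lemma ua_id (X : U) : ua (equiv_id (El X)) == idp.
Proof.
  refine (concat _ (inv_map_l (equiv_path X X) idp)).
  apply (ap ua), eq_to_Id; symmetry; apply idtoequiv_idp.
Qed.

Lemma ua_compose {X Y Z : U} (f : El X <~> El Y) (e : El Y <~> El Z)
  : ua (equiv_compose f e) == concat (ua f) (ua e).
Proof.
  assert (K : forall (Y : U) (p : X == Y) (Z : U) (q : Y == Z),
    ua (equiv_compose ((equiv_path X Y).1 p) ((equiv_path Y Z).1 q))
    == concat p q).
  { path_ind; path_ind; cbn; rewrite !idtoequiv_idp, concat_idp_l.
    refine (concat (ap ua _) (ua_id X)).
    apply path_equiv; exact idp. }
  refine (concat _ (K Y (ua f) Z (ua e))).
  apply (ap ua), path_equiv, path_forall; intro a; cbn.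
  refine (inverse _).
  refine (concat (ap (fun g : El Y <~> El Z => g.1 _)
    (inv_map_r (equiv_path Y Z) e)) _).
  exact (ap (fun g : El X <~> El Y => e.1 (g.1 a))
    (inv_map_r (equiv_path X Y) f)).
Qed.

Context {A : U}.

Lemma BAut1_connected (P : BAut1 A -> Type) {fP : forall x, fib (P x)}
    (hP : forall x, IsProp (P x)) : P (BAut1_pt A) -> forall x, P x.
Proof.
  intros h [X p]; revert p.
  refine (Trunc0_ind (fun p => P (X; p)) (fun p => isset_isprop (hP _)) _).
  revert X; path_ind; exact h.
Qed.

(** The second components of [x] and [y] are elements of sets, so a path is
    known once its effect on the first components is; [act] packages that
    effect without mentioning univalence. *)
Definition act {x y : BAut1 A} (q : x == y) : El x.1 -> El y.1 :=
  transport (fun x : BAut1 A => El x.1) q.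

Lemma act_concat {x y z : BAut1 A} (p : x == y) (q : y == z) (b : El x.1)
  : act (concat p q) b == act q (act p b).
Proof.
  revert q; revert y p; path_ind; intro q.
  unfold act; rewrite concat_idp_l, transport_idp; exact idp.
Qed.

Lemma act_inverse_l {x y : BAut1 A} (p : x == y) (b : El x.1)
  : act (inverse p) (act p b) == b.
Proof.
  revert y p; path_ind.
  unfold act; rewrite inverse_idp, !transport_idp; exact idp.
Qed.

Lemma act_sig_code {x y : BAut1 A} (q : x == y)
  : ((equiv_path x.1 y.1).1 (sig_code x y q).1).1 == act q.
Proof.
  revert y q; path_ind.
  apply path_forall; intro b; unfold act; rewrite transport_idp.
  unfold sig_code; rewrite J_idp; cbn; rewrite idtoequiv_idp; exact idp.
Qed.

(** Univalence reduces the first components of the paths to the maps that they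
    induce, and the second components are paths in sets. *)
Lemma path_act {x y : BAut1 A} (p q : x == y)
  : (forall b, act p b == act q b) -> p == q.
Proof.
  intro h.
  apply (equiv_inj (equiv_sig_code x y)), path_sig_prop.
  { intro r; apply isset_Trunc0. }
  apply (equiv_inj (equiv_path x.1 y.1)), path_equiv.
  refine (concat (act_sig_code p) (concat _ (inverse (act_sig_code q)))).
  exact (path_forall _ _ h).
Qed.

Lemma path_with_act (x y : BAut1 A) (q : x.1 == y.1)
    (h : transport (fun X => Trunc0 (A == X)) q x.2 == y.2
        :> Trunc0 (A == y.1))
  : {r : x == y & forall b, act r b == ((equiv_path x.1 y.1).1 q).1 b}.
Proof.
  destruct x as [X p], y as [Y p']; cbn in q, h |- *.
  revert p' h; revert Y q; path_ind; intro p'; rewrite transport_idp.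
  revert p'; path_ind; exists idp; intro b.
  unfold act; rewrite transport_idp, idtoequiv_idp; exact idp.
Qed.

(** A relational form of the band: it spares the computation of the set
    truncation of [equiv_path] on an element that is not literally a [tr]. *)
Definition Bands (x : BAut1 A) (f : El A <~> El x.1) : Type := x.2 == tr (ua f).

Lemma Bands_pt : Bands (BAut1_pt A) (equiv_id (El A)).
Proof. exact (ap tr (inverse (ua_id A))). Qed.

Lemma Bands_homotopic (x : BAut1 A) (f g : El A <~> El x.1)
  : (forall a, f.1 a == g.1 a) -> Bands x f -> Bands x g.
Proof.
  intros h b; refine (concat b (ap (fun e => tr (ua e)) _)).
  exact (path_equiv _ _ (path_forall _ _ h)).
Qed.

Lemma transport_band_concat {X Y : U} (r : A == X) (q : X == Y)
  : transport (fun X => Trunc0 (A == X)) q (tr r) == tr (concat r q).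
Proof.
  revert Y q; path_ind; rewrite transport_idp.
  exact (ap tr (inverse (concat_idp_r r))).
Qed.

(** To see that [e] respects the bands of [x] and [y], one representative of the
    band of [x] is enough. *)
Lemma transport_Bands (x y : BAut1 A) (f : El A <~> El x.1)
    (e : El x.1 <~> El y.1)
  : Bands x f -> Bands y (equiv_compose f e) ->
    transport (fun X => Trunc0 (A == X)) (ua e) x.2 == y.2
      :> Trunc0 (A == y.1).
Proof.
  intros h k.
  refine (concat (ap (transport _ (ua e)) h) (concat _ (inverse k))).
  refine (concat (transport_band_concat (ua f) (ua e)) _).
  exact (ap tr (inverse (ua_compose f e))).
Qed.

Lemma isequiv_conj {T : Type} {fT : fib T} {a b c d : T} (u : a == b)
    (v : c == d)
  : IsEquiv (fun q : a == c => concat (inverse u) (concat q v)).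
Proof.
  revert d v; path_ind; revert b u; path_ind.
  assert (H : forall q : a == c,
    concat (inverse idp) (concat q idp) == q).
  { intro q; rewrite inverse_idp, concat_idp_l; apply concat_idp_r. }
  exact (isequiv_qinv _ (fun q => q) H H).
Qed.

Definition equiv_conj {T : Type} {fT : fib T} {a b c d : T} (u : a == b)
    (v : c == d) : (a == c) <~> (b == d) :=
  (_; isequiv_conj u v).
End BandedPaths.

(** * The multiplication of a central type *)

Section Tensor.
Context {TT : TypeTheory} {FE : FunctionExtensionality} {ST : SetTruncation}
  {UU : UnivalentUniverse} {A : U} {pt : El A} (cA : IsCentral (El A) pt).

(** Injectivity of the evaluation map, which centrality makes an equivalence. *)
Lemma central_ext (f g : El A -> El A)
  : tr f == tr (fun x => x) -> tr g == tr (fun x => x) -> f pt == g pt ->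
    forall b, f b == g b.
Proof.
  intros hf hg h b.
  refine (ap (fun w => w.1 b)
    (equiv_inj (ev_equiv cA) (a := (f; hf)) (b := (g; hg)) h)).
Qed.

(** [A] is connected in the sense of [tr_central], so [b] may be moved to
    [pt]. *)
Lemma tr_mul_r (b : El A) : tr (fun a => mul cA a b) == tr (fun a => a).
Proof.
  refine (concat (tr_ap (fun b a => mul cA a b) (tr_central cA b)) _).
  exact (ap tr (path_forall _ _ (hspace_r _ _ _ (mul_IsHSpace cA)))).
Qed.

Lemma mul_comm : IsAbelian (El A) (mul cA).
Proof.
  intros a b; revert b; apply central_ext.
  - exact (inv_map (ev_equiv cA) a).2.
  - apply tr_mul_r.
  - refine (concat (hspace_r _ _ _ (mul_IsHSpace cA) a) (inverse _)).
    exact (hspace_l _ _ _ (mul_IsHSpace cA) a).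
Qed.

Lemma id_star_unique (a b : El A) : mul cA a b == pt -> id_star cA a == b.
Proof.
  intro p; refine (concat _ (inv_map_l (equiv_mul cA a) b)).
  exact (ap (inv_map (equiv_mul cA a)) (inverse p)).
Qed.

Lemma mul_id_star (a : El A) : mul cA a (id_star cA a) == pt.
Proof. exact (inv_map_r (equiv_mul cA a) pt). Qed.

Lemma id_star_involutive (a : El A) : id_star cA (id_star cA a) == a.
Proof.
  apply id_star_unique; exact (concat (mul_comm _ _) (mul_id_star a)).
Qed.

Lemma id_star_pt : id_star cA pt == pt.
Proof. apply id_star_unique, (hspace_l _ _ _ (mul_IsHSpace cA)). Qed.

(** In group notation [a (a c^-1)^-1 = c]; associativity is avoided by comparing
    the left-hand side, as a map of [c], with the identity. *)
Lemma mul_star_involutive (a c : El A)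
  : mul cA a (id_star cA (mul cA a (id_star cA c))) == c.
Proof.
  revert c.
  refine (central_ext
    (fun c => mul cA a (id_star cA (mul cA a (id_star cA c)))) (fun c => c)
    _ idp _).
  - refine (concat (tr_ap
      (fun a c => mul cA a (id_star cA (mul cA a (id_star cA c))))
      (tr_central cA a)) (ap tr (path_forall _ _ _))).
    intro c.
    pose proof (hspace_l _ _ _ (mul_IsHSpace cA)) as l.
    refine (concat (l _) (concat (ap (id_star cA) (l _)) _)).
    apply id_star_involutive.
  - refine (concat (ap (fun b => mul cA a (id_star cA b)) _) (mul_id_star a)).
    refine (concat (ap (mul cA a) id_star_pt) _).
    apply (hspace_r _ _ _ (mul_IsHSpace cA)).
Qed.

(** * Loops, duals and identity types of bands *)

Definition loop (a : El A) : BAut1_pt A == BAut1_pt A :=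
  inv_map (equiv_loops_ev cA) a.

(** The action of a loop lies in the component of the identity, so it is
    determined by its value at [pt], and [loop] inverts the evaluation there. *)
Lemma act_loop (a b : El A) : act (loop a) b == mul cA a b.
Proof.
  pose (w := (equiv_loops (A := A)).1 (loop a)).
  refine (concat (ap (fun f => f b) (inverse (act_sig_code (loop a)))) _).
  revert b; apply central_ext.
  - exact (tr_ap (fun e : El A <~> El A => e.1) w.2).
  - exact (inv_map (ev_equiv cA) a).2.
  - refine (concat (inv_map_r (equiv_loops_ev cA) a) (inverse _)).
    apply (hspace_r _ _ _ (mul_IsHSpace cA)).
Qed.

(** The band of [x == y] was defined by induction on truncated bands; this closed
    form is available as soon as [x] and [y] are joined to the base point. *)
Lemma Bands_Id {x y : BAut1 A} (u : BAut1_pt A == x) (v : BAut1_pt A == y)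
  : Bands (BAut1_Id x y; band cA x y)
      (equiv_compose (equiv_compose (equiv_inverse (equiv_loops_ev cA))
        (equiv_conj u v)) (equiv_inverse (equiv_BAut1_Id x y))).
Proof.
  revert y v; path_ind; revert x u; path_ind.
  apply (Bands_homotopic (BAut1_Id (BAut1_pt A) (BAut1_pt A); _)
    (equiv_compose (equiv_inverse (equiv_loops_ev cA))
      (equiv_inverse (equiv_BAut1_Id (BAut1_pt A) (BAut1_pt A))))).
  - intro a; cbn; apply ap.
    rewrite inverse_idp, concat_idp_l; exact (inverse (concat_idp_r _)).
  - unfold Bands; cbn.
    rewrite Trunc0_ind_tr, J_idp, Trunc0_ind_tr, J_idp; exact idp.
Qed.

Lemma path_pt_dual
  : {d : BAut1_pt A == dual cA (BAut1_pt A) &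
      forall b, act d b == id_star cA b}.
Proof.
  destruct (path_with_act (BAut1_pt A) (dual cA (BAut1_pt A)) (refl_star cA))
    as [d h].
  - refine (concat (transport_band _) _).
    cbn; unfold Trunc0_concat, Trunc0_rec.
    rewrite Trunc0_ind_tr, Trunc0_map_tr.
    exact (ap tr (inverse (concat_idp_r _))).
  - exists d; intro b; refine (concat (h b) _).
    exact (ap (fun e : El A <~> El A => e.1 b)
      (inv_map_r (equiv_path A A) (id_star cA; isequiv_id_star cA))).
Qed.

Lemma refl_star_concat : concat (refl_star cA) (refl_star cA) == idp.
Proof.
  refine (concat (inverse (ua_compose _ _)) (concat (ap ua _) (ua_id A))).
  apply path_equiv, path_forall; exact id_star_involutive.
Qed.

(** The path is the identity on underlying types; only the band changes, by
    [refl_star] composed with itself. *)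
Lemma path_dual_dual (x : BAut1 A)
  : {i : dual cA (dual cA x) == x & forall b, act i b == b}.
Proof.
  destruct (path_with_act (dual cA (dual cA x)) x idp) as [i h].
  - rewrite transport_idp; destruct x as [X p]; cbn; revert p.
    refine (Trunc0_ind _ (fun _ => isset_isprop (isset_Trunc0 _ _ _)) _).
    intro r; unfold Trunc0_concat, Trunc0_rec.
    rewrite !Trunc0_ind_tr, !Trunc0_map_tr.
    refine (ap tr (concat (concat_assoc _ _ _) _)).
    refine (concat (ap (fun z => concat z r) refl_star_concat) _).
    rewrite concat_idp_l; exact idp.
  - exists i; intro b; refine (concat (h b) _).
    cbn; rewrite idtoequiv_idp; exact idp.
Qed.

Lemma act_ap_dual {x y : BAut1 A} (q : x == y) (b : El x.1)
  : act (ap (dual cA) q) b == act q b.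
Proof.
  revert y q; path_ind; unfold act.
  rewrite ap_idp, !transport_idp; exact idp.
Qed.

(** * Commutativity *)

Definition swap {x y : BAut1 A} (q : dual cA x == y) : dual cA y == x :=
  concat (inverse (ap (dual cA) q)) (path_dual_dual x).1.

(** As dualizing does not change the underlying type, [swap q] acts as the
    inverse of [q]. *)
Lemma act_swap {x y : BAut1 A} (q : dual cA x == y) (b : El x.1)
  : act (swap q) (act q b) == b.
Proof.
  refine (concat (act_concat _ _ _) (concat ((path_dual_dual x).2 _) _)).
  refine (concat (ap (act (inverse (ap (dual cA) q)))
    (inverse (act_ap_dual q b))) _).
  apply (act_inverse_l (ap (dual cA) q)).
Qed.

Lemma swap_swap {x y : BAut1 A} (q : dual cA x == y) : swap (swap q) == q.
Proof.
  apply path_act; intro b.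
  refine (concat (ap (act (swap (swap q))) (inverse (act_swap q b))) _).
  apply act_swap.
Qed.

Definition equiv_swap (x y : BAut1 A) : (dual cA x == y) <~> (dual cA y == x) :=
  (swap; isequiv_qinv swap swap swap_swap swap_swap).

(** The tensor square of the base point is [pt^* == pt] rather than
    [pt == pt]; the representative of its band is shifted by the path
    from [pt] to [pt^*]. *)
Definition star_path
    : El A <~> (dual cA (BAut1_pt A) == BAut1_pt A) :=
  equiv_compose (equiv_inverse (equiv_loops_ev cA))
    (equiv_conj path_pt_dual.1 idp).

Lemma act_star_path (a b : El A)
  : act (star_path.1 a) b == mul cA a (id_star cA b).
Proof.
  pose (d := path_pt_dual.1).
  assert (H : act (inverse d) b == id_star cA b).
  { refine (concat (ap (act (inverse d)) (inverse _))
      (act_inverse_l d (id_star cA b))).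
    exact (concat (path_pt_dual.2 _) (id_star_involutive b)). }
  refine (concat (ap (fun q => act (concat (inverse d) q) b)
    (concat_idp_r (loop a))) _).
  refine (concat (act_concat _ _ _) (concat (ap (act (loop a)) H) _)).
  apply act_loop.
Qed.

Lemma Bands_tensor_pt
  : Bands (tensor cA (BAut1_pt A) (BAut1_pt A))
      (equiv_compose star_path (equiv_inverse (equiv_BAut1_Id _ _))).
Proof. exact (Bands_Id path_pt_dual.1 idp). Qed.

(** The action of [star_path.1 a] is its own inverse, and [swap] inverts
    actions. *)
Lemma swap_star_path (a : El A) : swap (star_path.1 a) == star_path.1 a.
Proof.
  apply path_act; intro b.
  set (q := star_path.1 a).
  assert (H : act q (act q b) == b).
  { refine (concat (act_star_path a _) _).
    refine (concat (ap (fun c => mul cA a (id_star cA c))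
      (act_star_path a b)) _).
    apply mul_star_involutive. }
  refine (concat (ap (act (swap q)) (inverse H)) _).
  apply act_swap.
Qed.

Lemma tensor_comm : IsAbelian (BAut1 A) (tensor cA).
Proof.
  intros x y.
  pose (e := fun x y : BAut1 A => equiv_compose (equiv_BAut1_Id (dual cA x) y)
    (equiv_compose (equiv_swap x y)
      (equiv_inverse (equiv_BAut1_Id (dual cA y) x)))).
  (* It remains to show that [e x y] respects bands. *)
  apply (path_sig (tensor cA x y) (tensor cA y x) (ua (e x y))).
  revert x; refine (BAut1_connected _ (fun x => isset_Trunc0 _ _ _) _).
  revert y; refine (BAut1_connected _ (fun y => isset_Trunc0 _ _ _) _).
  apply (transport_Bands (tensor cA (BAut1_pt A) (BAut1_pt A))
    (tensor cA (BAut1_pt A) (BAut1_pt A)) _ _ Bands_tensor_pt).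
  refine (Bands_homotopic _ _ _ _ Bands_tensor_pt).
  intro a; cbn; apply ap.
  refine (inverse (concat (ap swap (inv_map_r (equiv_BAut1_Id _ _) _)) _)).
  apply swap_star_path.
Qed.

(** * The unit laws *)

Definition ev_path (x : BAut1 A) (q : dual cA (BAut1_pt A) == x) : El x.1 :=
  act q pt.

Lemma ev_star_path (a : El A) : ev_path (BAut1_pt A) (star_path.1 a) == a.
Proof.
  refine (concat (act_star_path a pt) (concat (ap (mul cA a) id_star_pt) _)).
  apply (hspace_r _ _ _ (mul_IsHSpace cA)).
Qed.

(** Being an equivalence is a proposition, so it suffices to treat the base
    point, where [star_path] is the inverse. *)
Lemma isequiv_ev_path (x : BAut1 A) : IsEquiv (ev_path x).
Proof.
  revert x; refine (BAut1_connected _ (fun x => isprop_IsEquiv _) _).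
  refine (isequiv_qinv _ star_path.1 ev_star_path _).
  intro q.
  refine (concat _ (inv_map_r star_path q)).
  apply (ap star_path.1).
  refine (concat (ap _ (inverse (inv_map_r star_path q))) _).
  apply ev_star_path.
Qed.

Lemma tensor_pt_l (x : BAut1 A) : tensor cA (BAut1_pt A) x == x.
Proof.
  pose (e := fun x : BAut1 A =>
    equiv_compose (equiv_BAut1_Id (dual cA (BAut1_pt A)) x)
      (ev_path x; isequiv_ev_path x)).
  apply (path_sig (tensor cA (BAut1_pt A) x) x (ua (e x))).
  revert x; refine (BAut1_connected _ (fun x => isset_Trunc0 _ _ _) _).
  apply (transport_Bands (tensor cA (BAut1_pt A) (BAut1_pt A))
    (BAut1_pt A) _ _ Bands_tensor_pt).
  refine (Bands_homotopic _ _ _ _ Bands_pt).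
  intro a; cbn; refine (inverse _).
  refine (concat (ap (ev_path (BAut1_pt A))
    (inv_map_r (equiv_BAut1_Id _ _) _)) _).
  apply ev_star_path.
Qed.
End Tensor.

Theorem theorem4p19 (TT : TypeTheory) (FE : FunctionExtensionality)
    (ST : SetTruncation) (UU : UnivalentUniverse)
    (A : U) (pt : El A) (cA : IsCentral (El A) pt)
  : IsHSpace (BAut1 A) (BAut1_pt A) (tensor cA) * IsAbelian (BAut1 A) (tensor cA).
Proof.
  split; [| apply tensor_comm].
  apply IsHSpace_of_units; [apply tensor_pt_l |].
  intro x; exact (concat (tensor_comm cA _ _) (tensor_pt_l cA x)).
Qed.
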